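(* For every $\varepsilon>0$ there exists $C=C(\varepsilon)>0$ such that the following holds for every sufficiently large $n$. Let $G=(V_1,V_2)$ be a balanced bipartite graph with $|V_1|=|V_2|=n$. If $$\delta_{\{1\}}(G)+\delta_{\{2\}}(G)\ge(1+\varepsilon)n,$$ then there is a $(C/n)$-vertex-spread distribution on embeddings of perfect matchings in $G$.
   Context: For a bipartite graph $G=(V_1,V_2)$, $\delta_{\{1\}}(G)$ is the smallest degree of a vertex of $V_1$ and $\delta_{\{2\}}(G)$ the smallest degree of a vertex of $V_2$. An embedding $\varphi:M\hookrightarrow G$ is an injection $V(M)\to V(G)$ mapping edges to edges; ''embeddings of perfect matchings in $G$'' means embeddings of the graph $M$ consisting of $n$ vertex-disjoint edges. For $q\in[0,1]$, a probability distribution $\mu$ on such embeddings is $q$-vertex-spread if for every two sequences of distinct vertices $x_1,\dots,x_r\in V(M)$ and distinct $y_1,\dots,y_r\in V(G)$, $\mu(\{\varphi:\varphi(x_i)=y_i\ \forall i\in[r]\})\le q^r$. *)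

(* Defs.v *)
From HB Require Import structures.
From mathcomp Require Import all_boot all_order all_algebra.
From mathcomp Require Import reals.

Set Implicit Arguments.
Unset Strict Implicit.
Unset Printing Implicit Defensive.

Import Order.TTheory GRing.Theory Num.Theory.

Local Open Scope ring_scope.

Record sgraph := SGraph {
  vertex :> finType;
  adj : rel vertex;
  adj_sym : symmetric adj;
  adj_irrefl : irreflexive adj
}.

Definition bipartition (G : sgraph) (V1 V2 : {set G}) : Prop :=
  [/\ V1 :|: V2 = [set: G],
      V1 :&: V2 = set0 &
      forall x y : G, adj x y ->
        (x \in V1 /\ y \in V2) \/ (x \in V2 /\ y \in V1)].

Definition degree (G : sgraph) (x : G) : nat := #|[set y | adj x y]|.

(* The default value #|G| bounds every degree, so for A nonempty this is the
   minimum of the degrees of the vertices in A. *)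
Definition min_degree (G : sgraph) (A : {set G}) : nat :=
  \big[minn/#|G|]_(x in A) degree x.

(* n disjoint edges, the i-th one joining (i, false) and (i, true). *)
Definition matching_adj (n : nat) : rel ('I_n * bool) :=
  fun u v => (u.1 == v.1) && (u.2 != v.2).

Lemma matching_adj_sym n : symmetric (@matching_adj n).
Proof. by move=> u v; rewrite /matching_adj eq_sym [u.2 == _]eq_sym. Qed.

Lemma matching_adj_irrefl n : irreflexive (@matching_adj n).
Proof. by move=> u; rewrite /matching_adj !eqxx. Qed.

Definition matching_graph (n : nat) : sgraph :=
  SGraph (@matching_adj_sym n) (@matching_adj_irrefl n).

Definition is_embedding (M G : sgraph) (f : {ffun M -> G}) : bool :=
  injectiveb f && [forall x, forall y, adj x y ==> adj (f x) (f y)].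

Definition embedding (M G : sgraph) := {f : {ffun M -> G} | is_embedding f}.

Definition is_distribution (R : realType) (T : finType) (mu : {ffun T -> R}) :
    Prop :=
  (forall t, 0 <= mu t) /\ \sum_t mu t = 1.

Definition prob (R : realType) (T : finType) (mu : {ffun T -> R})
    (A : {set T}) : R :=
  \sum_(t in A) mu t.

Definition vertex_spread (R : realType) (M G : sgraph) (q : R)
    (mu : {ffun embedding M G -> R}) : Prop :=
  0 <= q <= 1 /\
  forall (r : nat) (x : r.-tuple M) (y : r.-tuple G), uniq x -> uniq y ->
    prob mu
      [set phi : embedding M G | [forall i, val phi (tnth x i) == tnth y i]]
    <= q ^+ r.

(* Main.v *)
(** Identify both sides with T, write perfect matchings of G as permutations s
    with e i (s i) for all i, and take a uniform perfect matching with its edges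
    labelled uniformly at random.  Let d be the excess of the sum of the minimum
    degrees over n.  The switching s |-> tperm x v * s, which exchanges the
    partners of x and v, has at least d values of v making both new pairs
    adjacent.  Applied row by row to arbitrary permutations it gives at least
    (d/n)^n n! perfect matchings.  Applied to matchings with k prescribed edges
    it shows that dropping one prescribed edge multiplies their number by at
    least d - k, so k <= d/2 prescribed edges have probability (O(1)/n)^k.  For
    larger k the trivial bound (n-k)! suffices, since the loss (n/d)^n is then
    exponential in k. *)

Require Import Defs.
From HB Require Import structures.
From mathcomp Require Import all_boot all_order all_algebra.
From mathcomp Require Import all_fingroup.
From mathcomp Require Import reals.
From mathcomp Require Import zify ring.

Set Implicit Arguments.
Unset Strict Implicit.
Unset Printing Implicit Defensive.

Import Order.TTheory GRing.Theory Num.Theory.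

Local Open Scope ring_scope.

(** * Factorial estimates and permutations with prescribed values *)

Section Counting.
Local Open Scope nat_scope.

Lemma leq_expn2r a b k : a <= b -> a ^ k <= b ^ k.
Proof. by case: k => // k; rewrite leq_exp2r. Qed.

(** The falling factorial of 2u with u factors dominates u^u; it equals C(2u,u) u!, and C(2u,u) <=
    4^u. *)
Lemma expn_self_leq_fact u : u ^ u <= 4 ^ u * u`!.
Proof.
have ltu (i : nat) : u ^ i <= (u + i) ^_ i.
  elim: i => [|i IHi]; first by rewrite ffactn0.
  rewrite expnS addnS ffactnS /= leq_mul //.
  by rewrite -addSn addSn -addnS leq_addr.
apply: leq_trans (ltu u) _; rewrite -bin_ffact leq_mul2r.
apply/orP; right; rewrite -[4]/(2 ^ 2) -expnM mul2n addnn.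
have bin_le (a b : nat) : 'C(a, b) <= 2 ^ a.
  elim: a b => [|a IHa] [|b]; rewrite ?bin0 ?expn_gt0 //.
  by rewrite binS expnS mul2n -addnn leq_add.
exact: bin_le.
Qed.

(** Since (n-j)/n >= (u-j)/u for j < u, the ratio of n^u to [n ^_ u] is at most u^u / u!, which
    reduces the claim to the case n = u. *)
Lemma expn_mul_fact_leq n u : u <= n -> n ^ u * (n - u)`! <= 4 ^ u * n`!.
Proof.
move=> le_un.
have [->|u_gt0] := posnP u; first by rewrite !expn0 subn0.
have cmp (i : nat) : i <= u -> n ^ i * u ^_ i <= n ^_ i * u ^ i.
  elim: i => // i IHi lt_iu; rewrite !ffactnSr !expnSr.
  have le_iu := ltnW lt_iu.
  rewrite mulnACA [leqRHS]mulnACA leq_mul ?IHi //.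
  by rewrite mulnBr mulnBl [n * u]mulnC; nia.
rewrite -(ffact_fact le_un) mulnA leq_mul2r; apply/orP; right.
have := cmp u (leqnn u); rewrite ffactnn => cmpu.
rewrite -(leq_pmul2r (fact_gt0 u)); apply: leq_trans cmpu _.
by rewrite mulnAC [leqRHS]mulnC leq_mul2l expn_self_leq_fact orbT.
Qed.

(** Right multiplication by the inverse of one member makes all of them fix [U] pointwise. *)
Lemma card_perm_agree (T : finType) (g : T -> T) (U : {set T}) :
  #|[set s : {perm T} | [forall i in U, s i == g i]]| <= (#|T| - #|U|)`!.
Proof.
have [->|[s0]] := set_0Vmem [set s : {perm T} | [forall i in U, s i == g i]].
  by rewrite cards0.
rewrite inE => /forall_inP s0P.
have -> : #|T| - #|U| = #|~: U| by rewrite [RHS]cardsCs setCK.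
rewrite -card_perm.
rewrite -(card_imset _ (mulIg s0^-1%g)); apply/subset_leq_card/subsetP => _ /imsetP [s + ->].
rewrite inE => /forall_inP sP; rewrite unfold_in; apply/subsetP => i.
rewrite !inE; apply: contra => iU.
by rewrite permM (eqP (sP i iU)) -(eqP (s0P i iU)) permK.
Qed.

End Counting.

(** * Switchings in perfect matchings *)

Section Switching.
Local Open Scope nat_scope.
Variables (T : finType) (e : rel T) (d : nat).
Hypothesis deg_sum : forall x y,
  #|T| + d <= #|[set j | e x j]| + #|[set i | e i y]|.

(* Only the rows in F need respect e; the rows in D are prescribed by t. *)
Definition matchings (F D : {set T}) (t : {perm T}) : {set {perm T}} :=
  [set s : {perm T} | [forall i in F, e i (s i)] && [forall i in D, s i == t i]].

(** The preimage under [s] of the neighbours of [x] and the set of neighbours of [s x] have sizes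
    summing to at least [#|T| + d], so they share [d] elements. *)
Lemma card_switch (s : {perm T}) x :
  d <= #|[set v | e x (s v) && e v (s x)]|.
Proof.
have -> : [set v | e x (s v) && e v (s x)]
          = (s @^-1: [set j | e x j]) :&: [set i | e i (s x)].
  by apply/setP => v; rewrite !inE.
have := deg_sum x (s x).
rewrite -(card_preimset [set j | e x j] (@perm_inj _ s)) -cardsUI addnC.
move=> le_d; rewrite -(leq_add2r #|T|); apply: leq_trans le_d _.
by rewrite addnC leq_add2l max_card.
Qed.

Lemma leq_card_dep_pairs (S V : finType) (A : {set S}) (B : S -> {set V}) c :
  {in A, forall s, c <= #|B s|} ->
  #|A| * c <= #|[set p : S * V | (p.1 \in A) && (p.2 \in B p.1)]|.
Proof.
move=> le_c; rewrite -sum_nat_const -sum1_card.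
rewrite (eq_bigl (fun p : S * V => (p.1 \in A) && (p.2 \in B p.1))); last first.
  by move=> p; rewrite inE.
rewrite -(pair_big_dep (fun s => s \in A) (fun s v => v \in B s) (fun _ _ => 1)) /=.
by apply: leq_sum => s sA; rewrite sum1_card le_c.
Qed.

(** Double counting of pairs (s, v): the switch makes row [x] good and keeps the rows of [F] good.
    Retaining [v] makes the map injective, at the cost of [#|T|] on the right. *)
Lemma matchings_addF (F : {set T}) t x : x \notin F ->
  #|matchings F set0 t| * d <= #|matchings (x |: F) set0 t| * #|T|.
Proof.
move=> xF.
pose B (s : {perm T}) := [set v | e x (s v) && e v (s x)].
have leB : {in matchings F set0 t, forall s, d <= #|B s|}.
  by move=> s _; apply: card_switch.
apply: leq_trans (leq_card_dep_pairs leB) _.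
set A := [set p | _].
pose h (p : {perm T} * T) := ((tperm x p.2 * p.1)%g, p.2).
have h_inj : injective h.
  by move=> [s v] [s' v'] [] /= + eqv; rewrite -eqv => /mulgI ->.
rewrite -(card_imset _ h_inj) -cardsT -cardsX.
apply/subset_leq_card/subsetP => _ /imsetP [[s v] + ->].
rewrite !inE /= => /andP [/andP [/forall_inP sF _] /andP [exv evx]].
rewrite andbT; apply/andP; split; last by apply/forall_inP => i; rewrite inE.
apply/forall_inP => i; rewrite !inE permM.
case: tpermP => [->|-> _|/eqP /negPf -> _ /=] //.
exact: sF.
Qed.

(** Here [v] avoids [D], so the switch gives up only the prescription at [x]. The pair (s, v) is
    recoverable from the switched matching alone, hence no factor [#|T|]. *)
Lemma matchings_addD (D : {set T}) t x : x \notin D ->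
  #|matchings setT (x |: D) t| * (d - #|D|) <= #|matchings setT D t|.
Proof.
move=> xD.
pose B (s : {perm T}) := [set v | e x (s v) && e v (s x)] :\: D.
have leB : {in matchings setT (x |: D) t, forall s, d - #|D| <= #|B s|}.
  move=> s _; rewrite cardsD leq_sub ?card_switch //.
  exact/subset_leq_card/subsetIr.
apply: leq_trans (leq_card_dep_pairs leB) _.
set A := [set p | _].
pose h (p : {perm T} * T) := (tperm x p.2 * p.1)%g.
(* The row v is recovered from the new matching as the row sent to t x. *)
have h_inj : {in A &, injective h}.
  have hv p : p \in A -> h p p.2 = t x.
    rewrite !inE /h => /andP [/andP [_ /forall_inP sD] _].
    by rewrite permM tpermR; apply/eqP/sD/setU11.
  move=> p q pA qA eqh.
  have eqv : p.2 = q.2 by apply: (@perm_inj _ (h p)); rewrite hv // eqh hv.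
  move: eqh eqv {pA qA}; case: p q => [s v] [s' v'] /= + eqv.
  by rewrite /h /= eqv => /mulgI ->.
rewrite -(card_in_imset h_inj).
apply/subset_leq_card/subsetP => _ /imsetP [[s v] + ->].
rewrite !inE /= => /andP [/andP [/forall_inP sF /forall_inP sD] /andP [vD /andP [exv evx]]].
apply/andP; split; apply/forall_inP => i; rewrite ?inE permM.
  by move=> _; case: tpermP => [->|->|_ _] //; apply: sF.
move=> iD; case: tpermP => [eqi|eqi|_ _].
- by move: iD; rewrite eqi (negPf xD).
- by move: iD; rewrite eqi /= (negPf vD).
by apply: sD; rewrite inE iD orbT.
Qed.

(** * Counts of perfect matchings, with the integer [m] in the role of 2|T|/d *)

Variable m : nat.
Hypothesis m_gt0 : 0 < m.
Hypothesis le_md : #|T|.*2 <= m * d.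

(** Rows enter [F] one at a time, each costing a factor |T|/d <= m. *)
Lemma fact_leq_matchings t : #|T|`! <= m ^ #|T| * #|matchings setT set0 t|.
Proof.
have [T0|T_gt0] := posnP #|T|.
  rewrite T0 expn0 mul1n card_gt0; apply/set0Pn; exists t; rewrite inE.
  by apply/andP; split; apply/forall_inP => i; have := card0_eq T0 i; rewrite inE.
have step k : k <= #|T| -> exists2 F : {set T}, #|F| = k &
    #|T|`! <= m ^ k * #|matchings F set0 t|.
  elim: k => [_|k IHk lt_k].
    exists set0; first by rewrite cards0.
    rewrite mul1n -[#|T|]cardsT -card_perm.
    apply/subset_leq_card/subsetP => s _; rewrite inE.
    by apply/andP; split; apply/forall_inP => i; rewrite inE.
  have [F cF leF] := IHk (ltnW lt_k).
  have [x xF] : exists x, x \notin F.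
    apply/existsP; rewrite -negb_forall; apply/negP => /forallP allF.
    have FT : F = setT by apply/setP => i; rewrite inE; exact: allF.
    by move: lt_k; rewrite -cF FT cardsT ltnn.
  exists (x |: F); first by rewrite cardsU1 xF cF.
  apply: leq_trans leF _; rewrite expnS [m * _]mulnC -mulnA leq_mul2l.
  apply/orP; right; rewrite -(leq_pmul2r T_gt0).
  have := matchings_addF t xF; nia.
have [F cF] := step _ (leqnn _).
by have -> : F = setT by apply/eqP; rewrite eqEcard subsetT cF cardsT leqnn.
Qed.

Lemma matchings_small (D : {set T}) t : m * #|D| <= #|T| ->
  #|T| ^ #|D| * #|matchings setT D t| <= m ^ #|D| * #|matchings setT set0 t|.
Proof.
move: {2}#|D| (erefl #|D|) => k; elim: k D => [|k IHk] D cD le_D.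
  by move/eqP: (cD); rewrite cards_eq0 => /eqP ->; rewrite cards0.
have [x xD] : exists x, x \in D by apply/card_gt0P; rewrite cD.
have eqD : x |: (D :\ x) = D by rewrite setD1K.
have cD' : #|D :\ x| = k by move: (cardsD1 x D); rewrite xD cD => -[].
have := IHk (D :\ x) cD'; rewrite cD' cD => /(_ _) IH.
have leIH : m * k <= #|T| by rewrite cD in le_D; nia.
have := @matchings_addD (D :\ x) t x; rewrite setD11 eqD cD' => /(_ isT) sw.
rewrite !expnS -!mulnA.
have {IH} := IH leIH; set N := #|matchings setT (D :\ x) t| in sw *.
set N1 := #|matchings setT D t| in sw *; set N0 := #|matchings _ _ _|.
move=> IH.
(* From 2|T| <= m d and m k <= |T| follows m (d - k) >= |T|. *)
have {}sw : #|T| * N1 <= m * N by rewrite cD in le_D; nia.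
rewrite mulnCA; apply: leq_trans (leq_mul (leqnn _) sw) _.
by rewrite mulnCA leq_mul2l IH orbT.
Qed.

Lemma matchings_spread (D : {set T}) t :
  #|T| ^ #|D| * #|matchings setT D t|
  <= (4 * m ^ m) ^ #|D| * #|matchings setT set0 t|.
Proof.
have [le_D|lt_D] := leqP (m * #|D|) #|T|.
  apply: leq_trans (matchings_small t le_D) _.
  rewrite leq_mul2r leq_expn2r ?orbT //.
  by apply: leq_trans (leq_pmull _ _); rewrite // -{1}[m]expn1 leq_pexp2l.
have leDT : #|D| <= #|T| by apply: max_card.
have le1 : #|matchings setT D t| <= (#|T| - #|D|)`!.
  apply: leq_trans (card_perm_agree t D); apply/subset_leq_card/subsetP => s.
  by rewrite !inE => /andP [].
apply: leq_trans (leq_mul (leqnn _) le1) _.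
apply: leq_trans (expn_mul_fact_leq leDT) _.
rewrite expnMn -mulnA leq_mul2l; apply/orP; right.
apply: leq_trans (fact_leq_matchings t) _.
(* As |T| < m |D|, the loss m^|T| is at most (m^m)^|D|. *)
by rewrite leq_mul2r -expnM leq_pexp2l ?orbT // ltnW.
Qed.

(* In a pair p, the matching edge labelled i joins p.1 i to p.2 (p.1 i).  Labels
   in S0 :&: S1 prescribe a whole matching edge, hence save a factor |T|
   both in p.2 and in p.1; the other labels in S0 :|: S1 only save one in p.1. *)
Lemma labelled_spread (S0 S1 : {set T}) (sg0 s0 : {perm T}) :
  #|[set p : {perm T} * {perm T} |
      [&& p.2 \in matchings setT set0 s0,
          [forall i in S0, p.1 i == sg0 i] &
          [forall i in S1, p.2 (p.1 i) == s0 (sg0 i)]]]|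
    * #|T| ^ (#|S0| + #|S1|)
  <= (16 * m ^ m) ^ (#|S0| + #|S1|) * (#|T|`! * #|matchings setT set0 s0|).
Proof.
set A := [set p | _]; set K := S0 :&: S1; set U := S0 :|: S1.
(* The rows of [p.2] at which a whole matching edge is prescribed. *)
pose D := sg0 @: K.
have cD : #|D| = #|K| by rewrite card_imset //; apply: perm_inj.
have leA : #|A| <= #|matchings setT D s0| * (#|T| - #|U|)`!.
  (* Once the matching [s] is known, a label in [S1] alone also determines its row, namely the
     partner of the prescribed column; so the labelling is prescribed on all of [U]. *)
  pose g (s : {perm T}) i := if i \in S0 then sg0 i else (s^-1)%g (s0 (sg0 i)).
  pose B s := [set sg : {perm T} | [forall i in U, sg i == g s i]].
  rewrite -sum_nat_const.
  have leB : \sum_(s in matchings setT D s0) #|B s| <=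
             \sum_(s in matchings setT D s0) (#|T| - #|U|)`!.
    by apply: leq_sum => s _; apply: card_perm_agree.
  apply: leq_trans leB.
  under eq_bigr do rewrite -sum1_card.
  rewrite pair_big_dep /=.
  rewrite sum1_card.
  pose h (p : {perm T} * {perm T}) := (p.2, p.1).
  have h_inj : injective h by move=> [a b] [c f] [-> ->].
  rewrite -(card_imset (mem A) h_inj); apply/subset_leq_card/subsetP.
  move=> _ /imsetP [[sg s] + ->]; rewrite !inE unfold_in /= !inE.
  move=> /and3P [/andP [-> _] /forall_inP sg0P /forall_inP s0P] /=.
  apply/andP; split; apply/forall_inP => i.
    move=> /imsetP [j /setIP [j0 j1] ->].
    by rewrite -(eqP (s0P j j1)) (eqP (sg0P j j0)).
  rewrite /g; case: ifP => [i0 _|i0]; first exact: sg0P.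
  by rewrite !inE i0 => i1; rewrite -(eqP (s0P i i1)) permK.
have spr := matchings_spread D s0; rewrite cD in spr.
have leU := expn_mul_fact_leq (max_card (mem U)).
rewrite -cardsUI -/U -/K.
apply: leq_trans (leq_mul leA (leqnn _)) _.
have := leq_mul leU spr.
have -> : #|T| ^ #|U| * (#|T| - #|U|)`! * (#|T| ^ #|K| * #|matchings setT D s0|)
  = #|matchings setT D s0| * (#|T| - #|U|)`! * #|T| ^ (#|U| + #|K|).
  by rewrite expnD; ring.
(* The factors 4 per element of [U] and 4 m^m per element of [K] are both at most 16 m^m. *)
move=> /leq_trans; apply; rewrite mulnACA leq_mul // expnD leq_mul //.
  by rewrite leq_expn2r //; have := expn_gt0 m m; rewrite m_gt0; lia.
by rewrite leq_expn2r // leq_mul2r orbT.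
Qed.
End Switching.

(** * Minimum degrees, parametrizations and uniform distributions *)

Lemma min_degree_leq (G : sgraph) (A : {set G}) x :
  x \in A -> (min_degree A <= degree x)%N.
Proof.
rewrite /min_degree => xA.
have : x \in index_enum G by rewrite mem_index_enum.
elim: (index_enum G) => [//|y s IHs]; rewrite inE big_cons.
case/predU1P => [<-|xs]; first by rewrite xA geq_minl.
by case: ifP => _; rewrite ?IHs // geq_min IHs ?orbT.
Qed.

Lemma set_parametrization (T : finType) (A : {set T}) n : #|A| = n ->
  exists2 f : 'I_n -> T, injective f & forall x, (x \in A) = (x \in codom f).
Proof.
move=> <-; exists enum_val; first exact: enum_val_inj.
move=> x; apply/idP/codomP => [xA|[i ->]]; last exact: enum_valP.
by exists (enum_rank_in xA x); rewrite enum_rankK_in.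
Qed.

Lemma uniform_pushforward (R : realType) (S T : finType) (P : {set S})
    (f : S -> T) : (0 < #|P|)%N ->
  exists2 mu : {ffun T -> R}, is_distribution mu &
    forall A, prob mu A = #|[set p in P | f p \in A]|%:R / #|P|%:R.
Proof.
move=> P_gt0.
pose mu : {ffun T -> R} :=
  [ffun t => #|[set p in P | f p == t]|%:R / #|P|%:R].
have muE A : prob mu A = #|[set p in P | f p \in A]|%:R / #|P|%:R.
  rewrite /prob (eq_bigr _ (fun t _ => ffunE _ t)) -mulr_suml -natr_sum.
  congr (_%:R / _); rewrite -sum1_card (partition_big f (mem A)) /=; last first.
    by move=> p; rewrite inE => /andP [].
  apply: eq_bigr => t tA; rewrite -sum1_card; apply: eq_bigl => p.
  by rewrite !inE -andbA; congr (_ && _); case: eqP => [->|]; rewrite ?tA ?andbF.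
exists mu => //; split=> [t|]; first by rewrite ffunE divr_ge0.
transitivity (prob mu setT); first by apply: eq_bigl => t; rewrite inE.
rewrite muE (_ : [set p in P | _] = P); last by apply/setP => p; rewrite !inE andbT.
by rewrite divff // pnatr_eq0 -lt0n.
Qed.

(** Splits the prescribed vertices of the matching graph into labels with prescribed first end and
    labels with prescribed second end. *)
Lemma card_split_bool (T : finType) (x : seq (T * bool)) : uniq x ->
  (#|[set i | (i, false) \in x]| + #|[set i | (i, true) \in x]| = size x)%N.
Proof.
move=> /card_uniqP <-.
have fibre b : #|[set i | (i, b) \in x]| = #|[set u in x | u.2 == b]|.
  rewrite -(card_imset _ (fun i j (E : (i, b) = (j, b)) => congr1 fst E)).
  apply: eq_card => -[i c]; rewrite [RHS]inE; apply/imsetP/andP => /=.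
    by case=> j; rewrite inE => jx [-> ->].
  by case=> ix /eqP <-; exists i; rewrite ?inE.
rewrite !fibre -[RHS]cardsE -[RHS](cardsID [set u | u.2 == false]).
by congr (_ + _)%N; apply: eq_card => -[i []]; rewrite !inE ?andbT ?andbF.
Qed.

(** * The uniformly labelled uniform perfect matching *)

Theorem theorem2p8 (R : realType) (eps : R) (heps : 0 < eps) :
  exists2 C : R, 0 < C &
    exists n0 : nat, forall n : nat, (n0 <= n)%N ->
    forall (G : sgraph) (V1 V2 : {set G}),
      bipartition V1 V2 -> #|V1| = n -> #|V2| = n ->
      (1 + eps) * n%:R <= (min_degree V1)%:R + (min_degree V2)%:R :> R ->
      exists mu : {ffun embedding (matching_graph n) G -> R},
        is_distribution mu /\ vertex_spread (C / n%:R) mu.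
Proof.
pose m := Num.bound (2 / eps).
have lt_m : 2 / eps < m%:R by apply: archi_boundP; rewrite divr_ge0 // ltW.
have m_gt0 : (0 < m)%N.
  by rewrite -(ltr_nat R); apply: le_lt_trans lt_m; rewrite divr_ge0 // ltW.
pose C := (16 * m ^ m)%N.
have C_gt0 : (0 < C)%N by rewrite muln_gt0 expn_gt0 m_gt0.
exists C%:R; first by rewrite ltr0n.
(* The threshold n >= C ensures C/n <= 1, as spreadness demands. *)
exists C => n le_Cn G V1 V2 [V12U V12I adjV] cV1 cV2 deg12.
have n_gt0 : (0 < n)%N by apply: leq_trans le_Cn.
have [f1 f1_inj V1E] := set_parametrization cV1.
have [f2 f2_inj V2E] := set_parametrization cV2.
have f1V i : f1 i \in V1 by rewrite V1E codom_f.
have f2V i : f2 i \in V2 by rewrite V2E codom_f.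
have V1N2 v : v \in V1 -> v \in V2 -> False.
  by move=> v1 v2; have := in_set0 v; rewrite -V12I inE v1 v2.
pose e : rel 'I_n := fun i j => adj (f1 i) (f2 j).
(* The subtraction does not truncate, by [le_n] below. *)
pose d := (min_degree V1 + min_degree V2 - n)%N.
have le_nd : n%:R * eps <= (min_degree V1 + min_degree V2)%:R - n%:R :> R.
  by rewrite natrD lerBrDl; apply: le_trans deg12; rewrite mulrDl mul1r mulrC.
have le_n : (n <= min_degree V1 + min_degree V2)%N.
  by rewrite -(ler_nat R) -subr_ge0; apply: le_trans le_nd; rewrite mulr_ge0 // ltW.
have le_md : (#|'I_n|.*2 <= m * d)%N.
  rewrite card_ord -(ler_nat R) natrM /d natrB //.
  apply: le_trans (ler_wpM2l (ler0n _ _) le_nd).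
  rewrite -muln2 natrM mulrCA ler_wpM2l // ltW //.
  by rewrite -ltr_pdivrMr.
have deg_sum i j :
    (#|'I_n| + d <= #|[set j | e i j]| + #|[set i | e i j]|)%N.
  rewrite card_ord /d subnKC // leq_add //.
    apply: leq_trans (min_degree_leq (f1V i)) _.
    rewrite -(card_imset _ f2_inj); apply/subset_leq_card/subsetP => y.
    rewrite inE => adjy.
    have : y \in V2 by case: (adjV _ _ adjy) => -[] // /(V1N2 _ (f1V i)).
    rewrite V2E => /codomP [k yE]; apply/imsetP; exists k => //.
    by rewrite inE /e -yE.
  apply: leq_trans (min_degree_leq (f2V j)) _.
  rewrite -(card_imset _ f1_inj); apply/subset_leq_card/subsetP => y.
  rewrite inE => adjy.
  have : y \in V1 by case: (adjV _ _ adjy) => -[] // /V1N2 /(_ (f2V j)).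
  rewrite V1E => /codomP [k yE]; apply/imsetP; exists k => //.
  by rewrite inE /e -yE adj_sym.
pose M := matchings e setT set0 1%g.
have ME t : matchings e setT set0 t = M.
  apply/setP => s; rewrite !inE; congr (_ && _).
  by apply/forall_inP/forall_inP => _ i; rewrite inE.
have M_gt0 : (0 < #|M|)%N.
  have := fact_leq_matchings deg_sum m_gt0 le_md 1%g.
  by case: (posnP #|M|) => // M0; rewrite -/M M0 muln0 leqNgt fact_gt0.
pose P := setX [set: {perm 'I_n}] M.
have cP : #|P| = (n`! * #|M|)%N by rewrite cardsX cardsT card_Sn.
have P_gt0 : (0 < #|P|)%N by rewrite cP muln_gt0 fact_gt0.
(* [p.2] is the perfect matching and [p.1] the labelling of its edges, through their ends in
   [V1]. *)
pose F (p : {perm 'I_n} * {perm 'I_n}) : {ffun matching_graph n -> G} :=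
  [ffun u : 'I_n * bool => if u.2 then f2 (p.2 (p.1 u.1)) else f1 (p.1 u.1)].
have FP p : p \in P -> is_embedding (F p).
  rewrite inE /= => /andP [_]; rewrite inE => /andP [/forall_inP eP _].
  apply/andP; split.
    apply/injectiveP => -[i a] [j b]; rewrite !ffunE /=.
    case: a b => [] [] Eij.
    - by rewrite (perm_inj (perm_inj (f2_inj _ _ Eij))).
    - by case: (@V1N2 (f1 (p.1 j))); rewrite // -Eij.
    - by case: (@V1N2 (f1 (p.1 i))); rewrite // Eij.
    - by rewrite (perm_inj (f1_inj _ _ Eij)).
  apply/forallP => -[i a]; apply/forallP => -[j b]; apply/implyP.
  rewrite /= /matching_adj /= => /andP [/eqP <-].
  case: a b => [] [] // _; rewrite !ffunE /=; first rewrite adj_sym.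
    exact: eP.
  exact: eP.
have [p0 p0P] : exists p, p \in P by apply/card_gt0P.
pose u0 : {f : {ffun matching_graph n -> G} | is_embedding f} :=
  exist (fun f => is_embedding f) (F p0) (FP p0 p0P).
(* The default [u0] is never returned on [P], by [FP]. *)
pose phi p : embedding (matching_graph n) G := insubd u0 (F p).
have [mu mu_distr muE] := uniform_pushforward R phi P_gt0.
exists mu; split=> //; split.
  rewrite divr_ge0 //= ler_pdivrMr ?ltr0n // mul1r ler_nat //.
move=> r x y ux uy; rewrite muE.
set X := [set p in P | _].
(* A nonempty event has a member [q], and prescribing the values [y] amounts to agreeing with [q] at
   the vertices of [x]. *)
have [->|[q qX]] := set_0Vmem X.
  by rewrite cards0 mul0r exprn_ge0 // divr_ge0.
pose S0 := [set i | (i, false) \in tval x].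
pose S1 := [set i | (i, true) \in tval x].
have cS : (#|S0| + #|S1| = r)%N by rewrite card_split_bool // size_tuple.
have XP p u : p \in X -> u \in tval x -> F p u = F q u.
  have XE p' : p' \in X -> forall i, F p' (tnth x i) = tnth y i.
    rewrite inE => /andP [p'P]; rewrite inE => /forallP p'E i.
    by rewrite -(eqP (p'E i)) insubdK //; apply: (FP _ p'P).
  by move=> pX /tnthP [i ->]; rewrite !XE.
have leX := labelled_spread deg_sum m_gt0 le_md S0 S1 q.1 q.2.
rewrite cS ME card_ord -cP in leX.
rewrite ler_pdivrMr ?ltr0n // expr_div_n mulrAC ler_pdivlMr ?exprn_gt0 ?ltr0n //.
rewrite -!natrX -!natrM ler_nat; apply: leq_trans leX.
rewrite leq_mul2r; apply/orP; right; apply/subset_leq_card/subsetP => p pX.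
move: (pX); rewrite !inE => /andP [/andP [_ pM] _].
rewrite pM /=; apply/andP; split; apply/forall_inP => i; rewrite inE => ix.
  by have := XP _ _ pX ix; rewrite !ffunE /= => /f1_inj ->.
by have := XP _ _ pX ix; rewrite !ffunE /= => /f2_inj ->.
Qed.
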